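(* Let $r\ge2$, let $\bm{\nu}=(\mu_1,\dots,\mu_{r-1})\in\mathcal{L}_\infty^{r-1}$ be a perfect system, let $\mu_r\in\mathcal{L}_m$ with $m<\infty$, and let $\Phi(x)=\prod_{j=1}^m(x-z_j)$ be the monic orthogonal polynomial of degree $m$ of $\mu_r$, with $z_1,\dots,z_m$ distinct. Let $\bm{\mu}=(\mu_1,\dots,\mu_r)$, $\widehat{\bm{\nu}}=(\Phi\mu_1,\dots,\Phi\mu_{r-1})$, and $\bm{k}\in\mathbb{N}^{r-1}$. Let $\{\bm{s}_j\}_{j=0}^{(r-1)m}$ be a sequence in $\mathbb{N}^{r-1}$ with $|\bm{s}_j|=j$ and all components of $\bm{s}_j$ at most $m$, for each $j=0,1,\dots,(r-1)m$. Put $$D_{\bm{k}}=\det\begin{pmatrix}\bm{A}_{\bm{k}+\bm{s}_1}(z_1)&\bm{A}_{\bm{k}+\bm{s}_2}(z_1)&\cdots&\bm{A}_{\bm{k}+\bm{s}_{(r-1)m}}(z_1)\\\vdots&\vdots&\ddots&\vdots\\\bm{A}_{\bm{k}+\bm{s}_1}(z_m)&\bm{A}_{\bm{k}+\bm{s}_2}(z_m)&\cdots&\bm{A}_{\bm{k}+\bm{s}_{(r-1)m}}(z_m)\end{pmatrix},$$ where $\bm{A}_{\bm{n}}(z)$ denotes the column vector with entries $A^{(1)}_{\bm{n}}(z),\dots,A^{(r-1)}_{\bm{n}}(z)$, the type I polynomials of $\bm{\nu}$. If $(\bm{k},m)$ is normal for $\bm{\mu}$, then $D_{\bm{k}}\neq0$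 and, for $1\le j\le r-1$, $$A^{(j)}_{(\bm{k},m)}(x)=\widehat{A}^{(j)}_{\bm{k}}(x)=\Phi(x)^{-1}D_{\bm{k}}^{-1}\det\begin{pmatrix}A^{(j)}_{\bm{k}}(x)&A^{(j)}_{\bm{k}+\bm{s}_1}(x)&\cdots&A^{(j)}_{\bm{k}+\bm{s}_{(r-1)m}}(x)\\\bm{A}_{\bm{k}}(z_1)&\bm{A}_{\bm{k}+\bm{s}_1}(z_1)&\cdots&\bm{A}_{\bm{k}+\bm{s}_{(r-1)m}}(z_1)\\\vdots&\vdots&\ddots&\vdots\\\bm{A}_{\bm{k}}(z_m)&\bm{A}_{\bm{k}+\bm{s}_1}(z_m)&\cdots&\bm{A}_{\bm{k}+\bm{s}_{(r-1)m}}(z_m)\end{pmatrix},$$ where $A^{(j)}_{(\bm{k},m)}$ is the $j$-th type I polynomial of $\bm{\mu}$ at $(\bm{k},m)$ and $\widehat A^{(j)}_{\bm{k}}$ is the $j$-th type I polynomial of $\widehat{\bm{\nu}}$ at $\bm{k}$.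
   Context: $\mathbb{N}=\{0,1,2,\dots\}$. A moment functional is a linear map $\mu:\mathbb{C}[x]\to\mathbb{C}$; put $\Delta_n=\det(\mu[x^{i+k}])_{i,k=0}^{n-1}$. For $N\in\{1,2,\dots\}$, $\mathcal{L}_N$ is the set of $\mu$ with $\Delta_n\ne0$ for $1\le n\le N$ and $\Delta_n=0$ for $n>N$; $\mathcal{L}_\infty$ is the set of $\mu$ with $\Delta_n\neq0$ for all $n$. The monic orthogonal polynomial of degree $m$ of $\mu\in\mathcal{L}_m$ is the unique monic $P$ of degree $m$ with $\mu[P(x)x^p]=0$, $0\le p\le m-1$. $\Phi\mu$ is the functional $f\mapsto\mu[\Phi f]$. For a system $(\mu_1,\dots,\mu_s)$ of moment functionals and $\bm{n}\in\mathbb{N}^s$, $|\bm{n}|=\sum n_j$, the index $\bm{n}\neq\bm{0}$ is normal if there is a unique vector of polynomials $\bm{A}_{\bm{n}}=(A^{(1)}_{\bm{n}},\dots,A^{(s)}_{\bm{n}})$ with $\deg A^{(j)}_{\bm{n}}\le n_j-1$ (so $A^{(j)}_{\bm n}=0$ if $n_j=0$), $\sum_j\mu_j[A^{(j)}_{\bm{n}}(x)x^p]=0$ for $0\le p\le|\bm{n}|-2$ and $\sum_j\mu_j[A^{(j)}_{\bm{n}}(x)x^{|\bm{n}|-1}]=1$; this $\bm{A}_{\bm{n}}$ is the type I multiple orthogonal polynomial. Equivalently, every nonzero polynomial $P$ with $\deg P\le|\bm{n}|$ and $\mu_j[Px^p]=0$ for $0\le p\le n_j-1$, $1\le j\le s$,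 has degree exactly $|\bm{n}|$. $\bm{0}$ is normal with $\bm{A}_{\bm{0}}=\bm{0}$. $\bm{\nu}$ is perfect if all $\bm{n}\in\mathbb{N}^{r-1}$ are normal. If $(\bm{k},m)$ is normal for $\bm{\mu}$ then $\bm{k}$ is normal for $\widehat{\bm{\nu}}$. *)

(* Defs.v *)
From HB Require Import structures.
From mathcomp Require Import all_boot all_order all_algebra.
From mathcomp Require Import complex boolp classical_sets reals.

Set Implicit Arguments.
Unset Strict Implicit.
Unset Printing Implicit Defensive.

Import GRing.Theory.
Local Open Scope ring_scope.

Section MomentFunctional.
Variable F : fieldType.
Implicit Types (mu : {scalar {poly F}}) (P : {poly F}).

Definition hankel mu (n : nat) : F := \det (\matrix_(i < n, k < n) mu 'X^(i + k)).

Definition in_L (N : nat) mu : Prop :=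
  [/\ (0 < N)%N,
      forall n, (0 < n <= N)%N -> hankel mu n != 0
    & forall n, (N < n)%N -> hankel mu n = 0].

Definition in_Linf mu : Prop := forall n, hankel mu n != 0.

Definition is_monic_op mu (m : nat) P : Prop :=
  [/\ P \is monic, size P = m.+1
    & forall p, (p < m)%N -> mu (P * 'X^p) = 0].

Definition mulfun P mu (f : {poly F}) : F := mu (P * f).

Fact mulfun_is_scalar P mu : scalar (mulfun P mu).
Proof. by move=> a f g; rewrite /mulfun mulrDr -scalerAr linearP. Qed.

HB.instance Definition _ P mu :=
  GRing.isLinear.Build F {poly F} F *%R (mulfun P mu) (mulfun_is_scalar P mu).

End MomentFunctional.

(* The i-th entry (i < q) is at lift ord_max i, which has value i; the appended
   one is at ord_max. *)
Definition snoc (T : Type) (q : nat) (f : 'I_q -> T) (x : T) (i : 'I_q.+1) : T :=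
  if unlift ord_max i is Some j then f j else x.

Definition mabs (s : nat) (n : {ffun 'I_s -> nat}) : nat := (\sum_i n i)%N.

Section TypeI.
Variables (F : fieldType) (s : nat) (mu : 'I_s -> {scalar {poly F}}).
Implicit Types (n : {ffun 'I_s -> nat}) (A : {ffun 'I_s -> {poly F}}).

(* For n = 0 the degree bounds alone force A = 0, so that the index 0 is
   normal and its type I vector is 0. *)
Definition is_typeI n A : Prop :=
  [/\ forall j, (size (A j) <= n j)%N,
      forall p, (p.+2 <= mabs n)%N -> \sum_j mu j (A j * 'X^p) = 0
    & (0 < mabs n)%N -> \sum_j mu j (A j * 'X^((mabs n).-1)) = 1].

Definition normal n : Prop := exists! A, is_typeI n A.

Definition perfect : Prop := forall n, normal n.

(* Meaningful when n is normal. *)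
Definition typeI n : {ffun 'I_s -> {poly F}} := xget 0 (is_typeI n).

End TypeI.

Section Determinants.
Variables (F : fieldType) (q m : nat) (nu : 'I_q -> {scalar {poly F}}).
Variables (z : 'I_m -> F) (s : nat -> {ffun 'I_q -> nat}).
Implicit Types (k n : {ffun 'I_q -> nat}).

(* The column A_n(z_1), ..., A_n(z_m) of stacked vectors: mxvec is row-major,
   hence the blocks are ordered by the index of z. *)
Definition typeI_stack n : 'cV[F]_(m * q) :=
  (mxvec (\matrix_(i < m, j < q) (typeI nu n j).[z i]))^T.

(* Columns are indexed from 0, so column b carries the multi-index k + s_(b+1);
   the sum of multi-indices is the pointwise one. *)
Definition Dmx k : 'M[F]_(m * q) :=
  \matrix_(a, b) typeI_stack (k + s b.+1) a 0.

Definition bordered_mx k (j : 'I_q) : 'M[{poly F}]_(1 + m * q) :=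
  block_mx
    (typeI nu k j)%:M            (\row_(b < m * q) typeI nu (k + s b.+1) j)
    (map_mx polyC (typeI_stack k)) (map_mx polyC (Dmx k)).

End Determinants.

(* Main.v *)
(* The bilinear pairing (A, f) |-> sum_j mu_j (A_j f) turns the type I conditions
   into: A has small degrees and pairs with every f of degree < |n| to the
   coefficient of degree |n|-1 of f.  Since mu_r vanishes on all multiples of
   Phi, testing the type I vector at (k, m) on multiples of Phi shows that its
   first r-1 entries are the type I vector of nuhat at k.
   For D_k: a combination of the A_(k+s_b), b >= 1, annihilates degrees < |k|; if
   it also vanishes at all z_i then its quotient by Phi is a null vector for nuhat
   at k, hence 0, and the A_(k+s_b) are independent because their pairings with
   the monomials x^(|k|+b-1) are triangular.  For the formula: choosing the
   combination that agrees with A_k at all z_i and subtracting it from A_k gives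
   Phi times the type I vector of nuhat, and this difference is the Schur
   complement of D_k in the bordered matrix. *)
From HB Require Import structures.
Require Import Defs.
From mathcomp Require Import all_boot all_order all_algebra.
From mathcomp Require Import zify.
From mathcomp Require Import complex boolp classical_sets reals.

Import GRing.Theory.
Local Open Scope ring_scope.

(** * Moment functionals and their Hankel forms *)

Section Functionals.
Context {F : fieldType}.
Implicit Types (mu L : {scalar {poly F}}) (P Q f : {poly F}).

Lemma mulfunE P mu f : (mulfun P mu : {scalar {poly F}}) f = mu (P * f).
Proof. by []. Qed.

Lemma scalar_polyE {L n f} :
  (size f <= n)%N -> L f = \sum_(p < n) f`_p * L 'X^p.
Proof.
move=> fn; rewrite -{1}(coefK f) poly_def linear_sum /=.
under eq_bigr do rewrite linearZ /=.
rewrite (big_ord_widen n (fun i => f`_i * L 'X^i)) // big_mkcond /=.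
apply: eq_bigr => i _; case: ifP => // /negbT; rewrite -leqNgt => fi.
by rewrite nth_default // mul0r.
Qed.

Lemma scalar_eq0 {L n f} : (forall p, (p < n)%N -> L 'X^p = 0) ->
  (size f <= n)%N -> L f = 0.
Proof.
move=> L0 fn; rewrite (scalar_polyE fn) big1 // => i _.
by rewrite L0 // mulr0.
Qed.

Lemma hankel_nondeg {mu n P} : hankel mu n != 0 -> (size P <= n)%N ->
  (forall p, (p < n)%N -> mu (P * 'X^p) = 0) -> P = 0.
Proof.
move=> muN0 Pn orth; apply: contraNeq muN0 => PN0; apply/det0P.
exists (poly_rV P : 'rV_n).
  by apply: contraNneq PN0 => P0; rewrite -(poly_rV_K Pn) P0 linear0.
apply/rowP => p; rewrite !mxE -[RHS](orth p (ltn_ord p)).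
rewrite mulrC -mulfunE.
rewrite (scalar_polyE Pn); apply: eq_bigr => i _.
by rewrite !mxE mulfunE -exprD addnC.
Qed.

(** A kernel vector of the singular Hankel matrix, read as coefficients, lies in the radical of the
    form (P, f) -> mu (P f) in degrees below n. *)
Lemma hankel_deg {mu n} : hankel mu n = 0 -> exists P,
  [/\ P != 0, (size P <= n)%N & forall f, (size f <= n)%N -> mu (P * f) = 0].
Proof.
move=> /eqP /det0P [v vN0 v0]; exists (rVpoly v); split.
- by apply: contraNneq vN0 => P0; rewrite -(rVpolyK v) P0 linear0.
- exact: size_poly.
move=> f fn; rewrite -mulfunE.
apply: scalar_eq0 fn => p pn; rewrite mulfunE mulrC -mulfunE.
have /rowP /(_ (Ordinal pn)) := v0; rewrite !mxE => <-.
rewrite (scalar_polyE (size_poly _ _)); apply: eq_bigr => i _.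
by rewrite !mxE mulfunE coef_rVpoly_ord -exprD addnC.
Qed.

Lemma hankel_surj {mu n} (c : nat -> F) : hankel mu n != 0 -> exists P,
  (size P <= n)%N /\ forall p, (p < n)%N -> mu (P * 'X^p) = c p.
Proof.
move=> muN0; set H := \matrix_(i < n, j < n) mu 'X^(i + j).
have Hu : H \in unitmx by rewrite unitmxE unitfE.
exists (rVpoly ((\row_j c j) *m invmx H)); split; first exact: size_poly.
move=> p pn; rewrite mulrC -mulfunE.
have /rowP /(_ (Ordinal pn)) := mulmxKV Hu (\row_(j < n) c j).
rewrite !mxE => <-.
rewrite (scalar_polyE (size_poly _ _)); apply: eq_bigr => i _.
by rewrite [H _ _]mxE mulfunE coef_rVpoly_ord -exprD addnC.
Qed.

(* At the first p with mu (Phi * 'X^p) <> 0 the Hankel form of size p.+1 would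
   be nondegenerate: on the multiples of Phi it is antitriangular. *)
Lemma monic_op_ann {mu m} {Phi : {poly F}} :
  in_L m mu -> is_monic_op mu m Phi -> forall f, mu (Phi * f) = 0.
Proof.
move=> [m_gt0 muN0 mu0] [Phi_monic sPhi orth] f.
rewrite -mulfunE.
apply: scalar_eq0 (leqnn (size f)) => + _.
elim/ltn_ind => p IH; rewrite mulfunE.
have [/orth// | mp] := ltnP p m.
have [P [PN0 sP Porth]] := hankel_deg (mu0 p.+1 mp).
apply/eqP/negP => /negP pN0.
have PhiN0 : Phi != 0 by rewrite monic_neq0.
have low (g : {poly F}) : (size g <= p)%N -> mu (Phi * g) = 0.
  by move=> gp; apply: (@scalar_eq0 (mulfun Phi mu) p g).
have sV : (size (P %% Phi)%R <= m)%N by rewrite -ltnS -sPhi ltn_modp.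
have sU : (size (P %/ Phi)%R <= p.+1 - m)%N.
  by rewrite size_divp // sPhi leq_sub2r.
(* For i < m, [(P %/ Phi) * 'X^i] has degree below p and is handled by [low]. So the remainder is
   orthogonal to these powers, and nondegeneracy in order m kills it. *)
have V0 : P %% Phi = 0.
  apply: (@hankel_nondeg mu m) => //; first by rewrite muN0 // m_gt0 leqnn.
  move=> i im; have : mu (P * 'X^i) = 0.
    by rewrite Porth // size_polyXn ltnS ltnW // (leq_trans im).
  rewrite {1}(divp_eq P Phi) mulrDl linearD /= mulrAC mulrC.
  rewrite low ?add0r //.
  have [->|UN0] := eqVneq (P %/ Phi) 0; first by rewrite mul0r size_poly0.
  by rewrite size_mulXn //; move: (size _) sU => d; lia.
have PE : P = P %/ Phi * Phi by rewrite {1}(divp_eq P Phi) V0 addr0.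
set U := P %/ Phi in sU PE.
have UN0 : U != 0 by apply: contraNneq PN0 => U0; rewrite PE U0 mul0r.
have sU0 : (0 < size U)%N by rewrite size_poly_gt0.
(* This exponent raises U to degree exactly p, so only its leading coefficient meets a moment of Phi
   not yet known to vanish. *)
have : mu (P * 'X^(p.+1 - size U)) = 0.
  rewrite Porth // size_polyXn; lia.
have sUX : size (U * 'X^(p.+1 - size U)) = p.+1 by rewrite size_mulXn //; lia.
rewrite PE mulrAC mulrC -mulfunE.
rewrite (@scalar_polyE _ p.+1 _) ?sUX // big_ord_recr big1 /= => [|i _]; last first.
  by rewrite IH // mulr0.
rewrite add0r => /eqP; rewrite mulf_eq0 /= (negPf pN0) orbF.
suff : lead_coef (U * 'X^(p.+1 - size U)) != 0 by rewrite /lead_coef sUX => /negPf->.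
by rewrite lead_coef_eq0 -size_poly_gt0 sUX.
Qed.

End Functionals.

Lemma widen_ord_lift n (j : 'I_n) : widen_ord (leqnSn n) j = lift ord_max j.
Proof. exact/esym/val_inj/lift_max. Qed.

(** * Type I conditions as a linear pairing, and normality *)

Section TypeI.
Context {F : fieldType} {q : nat}.
Implicit Types (mu : 'I_q -> {scalar {poly F}}) (A B : {ffun 'I_q -> {poly F}}).
Implicit Types (n : {ffun 'I_q -> nat}) (f : {poly F}).

Definition pairing mu A f : F := \sum_j mu j (A j * f).

Fact pairing_is_scalar mu A : scalar (pairing mu A).
Proof.
move=> a f g; rewrite /pairing mulr_sumr -big_split /=; apply: eq_bigr => j _.
by rewrite mulrDr -scalerAr linearP.
Qed.

HB.instance Definition _ mu A := GRing.isLinear.Build F {poly F} F *%R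
  (pairing mu A) (pairing_is_scalar mu A).

Lemma pairingDl mu A B f : pairing mu (A + B) f = pairing mu A f + pairing mu B f.
Proof.
by rewrite /pairing -big_split; apply: eq_bigr => j _; rewrite ffunE mulrDl linearD.
Qed.

Lemma pairingZl mu a A f : pairing mu (a *: A) f = a * pairing mu A f.
Proof.
rewrite /pairing mulr_sumr; apply: eq_bigr => j _.
by rewrite ffunE -scalerAl linearZ.
Qed.

Lemma pairingBl mu A B f : pairing mu (A - B) f = pairing mu A f - pairing mu B f.
Proof. by rewrite pairingDl -scaleN1r pairingZl mulN1r. Qed.

Lemma pairing_suml mu N (c : 'I_N -> F) (A : 'I_N -> {ffun 'I_q -> {poly F}}) f :
  pairing mu (\sum_b c b *: A b) f = \sum_b c b * pairing mu (A b) f.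
Proof.
elim/big_ind2: _ => [|x a y b <- <-|b _].
- by rewrite /pairing big1 // => j _; rewrite ffunE mul0r linear0.
- by rewrite pairingDl.
- by rewrite pairingZl.
Qed.

(** Linearity in f merges orthogonality and normalization. For |n| = 0 only f = 0 is allowed, so the
    truncated predecessor is harmless. *)
Lemma is_typeIP mu n A : is_typeI mu n A <->
  (forall j, (size (A j) <= n j)%N) /\
  (forall f, (size f <= mabs n)%N -> pairing mu A f = f`_(mabs n).-1).
Proof.
split=> [[sA orth nrm]|[sA pA]]; split=> //.
- move=> f; have [->|n_gt0] := posnP (mabs n).
    by rewrite leqn0 size_poly_eq0 => /eqP->; rewrite linear0 coef0.
  move=> fn; rewrite (scalar_polyE fn); move: fn orth nrm.
  case: (mabs n) n_gt0 => // N _ fn orth nrm.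
  rewrite big_ord_recr big1 /= => [|i _]; first by rewrite [pairing _ _ _]nrm // mulr1 add0r.
  by rewrite [pairing _ _ _]orth ?mulr0 // !ltnS.
- move=> p pn; rewrite -[LHS]/(pairing mu A 'X^p) pA ?size_polyXn ?(ltnW pn) //.
  by rewrite coefXn; case: eqP => // pE; lia.
- move=> n_gt0; rewrite -[LHS]/(pairing mu A 'X^((mabs n).-1)).
  by rewrite pA ?size_polyXn ?coefXn ?eqxx ?prednK.
Qed.

Definition null_typeI mu n A :=
  (forall j, (size (A j) <= n j)%N) /\
  (forall f, (size f <= mabs n)%N -> pairing mu A f = 0).

Lemma is_typeI_sub mu n A B :
  is_typeI mu n A -> is_typeI mu n B -> null_typeI mu n (A - B).
Proof.
move=> /is_typeIP [sA pA] /is_typeIP [sB pB]; split=> [j|f fn].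
  rewrite !ffunE (leq_trans (size_polyD _ _)) // size_polyN geq_max sA sB //.
by rewrite pairingBl pA // pB // subrr.
Qed.

(** Type I vectors form a coset of the null vectors, so uniqueness means that the homogeneous system
    has only the zero solution. *)
Lemma normalP mu n : normal mu n <->
  (exists A, is_typeI mu n A) /\ (forall B, null_typeI mu n B -> B = 0).
Proof.
split=> [[A [tA uA]]|[[A tA] null0]].
  split=> [|B [sB pB]]; first by exists A.
  apply: (@addrI _ A); rewrite addr0 -(uA (A + B)) //.
  move/is_typeIP: tA => [sA pA]; apply/is_typeIP; split=> [j|f fn].
    by rewrite ffunE (leq_trans (size_polyD _ _)) // geq_max sA sB.
  by rewrite pairingDl pA // pB // addr0.
exists A; split=> // B tB; apply/eqP; rewrite -subr_eq0; apply/eqP.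
exact/null0/is_typeI_sub.
Qed.

Lemma typeIP {mu n} : normal mu n -> is_typeI mu n (typeI mu n).
Proof. by move=> [A [tA _]]; exact: (@xgetPex _ 0 (is_typeI mu n) (ex_intro _ A tA)). Qed.

Lemma typeI_unique {mu n A} : normal mu n -> is_typeI mu n A -> typeI mu n = A.
Proof. by move=> nn tA; have [B [_ uB]] := nn; rewrite -(uB A) // -(uB _ (typeIP nn)). Qed.

Lemma mabsD n n' : mabs (n + n') = (mabs n + mabs n')%N.
Proof. by rewrite /mabs -big_split; apply: eq_bigr => j _; rewrite ffunE. Qed.

Lemma mabs_snoc n (m : nat) : mabs [ffun i => snoc n m i] = (mabs n + m)%N.
Proof.
rewrite /mabs big_ord_recr /= ffunE /snoc unlift_none; congr (_ + _)%N.
apply: eq_bigr => j _.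
by rewrite widen_ord_lift ffunE liftK.
Qed.

End TypeI.

(** * Multiplying functionals by Phi: from the index (k, m) to k *)

Section Transform.
Context {F : fieldType} {q m : nat}.
Variables (nu : 'I_q -> {scalar {poly F}}) (Phi : {poly F}).
Implicit Types (A B : {ffun 'I_q -> {poly F}}) (k : {ffun 'I_q -> nat}).

Local Notation nuhat :=
  (fun j : 'I_q => (mulfun Phi (nu j) : {scalar {poly F}})).

Lemma pairing_mulfun A f : pairing nuhat A f = pairing nu A (Phi * f).
Proof. by apply: eq_bigr => j _; rewrite mulfunE mulrCA. Qed.

Lemma pairing_mulfunl A f :
  pairing nuhat A f = pairing nu [ffun j => Phi * A j] f.
Proof. by apply: eq_bigr => j _; rewrite ffunE mulfunE mulrA. Qed.

Lemma pairing_snoc mur (A : {ffun 'I_q.+1 -> {poly F}}) f :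
  pairing (snoc nu mur) A f =
  pairing nu [ffun j => A (lift ord_max j)] f + mur (A ord_max * f).
Proof.
rewrite /pairing big_ord_recr /= {2}/snoc unlift_none; congr (_ + _).
apply: eq_bigr => j _; rewrite ffunE.
by rewrite widen_ord_lift /snoc liftK.
Qed.

Hypotheses (Phi_monic : Phi \is monic) (sPhi : size Phi = m.+1).

(** Either both sides are the leading coefficient of f, or both vanish. This carries the
    normalization from degree |k| + m - 1 to degree |k| - 1. *)
Lemma coef_mul_monic (f : {poly F}) n :
  (size f <= n.+1)%N -> (Phi * f)`_(m + n) = f`_n.
Proof.
rewrite leq_eqVlt => /predU1P[sf|sf]; last first.
  rewrite !nth_default // (leq_trans (size_polyMleq _ _)) // sPhi addSn.
  by rewrite leq_add2l.
have f0 : f != 0 by rewrite -size_poly_gt0 sf.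
have := lead_coef_monicM f Phi_monic; rewrite /lead_coef sf => <-.
by rewrite size_monicM // sPhi sf !addSn addnS.
Qed.

Section Projection.
Variables (mur : {scalar {poly F}}) (k : {ffun 'I_q -> nat}).
Hypotheses (mur_L : in_L m mur) (Phi_op : is_monic_op mur m Phi).

Local Notation km := [ffun i => snoc k m i].

Lemma is_typeI_restrict (A : {ffun 'I_q.+1 -> {poly F}}) : is_typeI (snoc nu mur) km A ->
  is_typeI nuhat k [ffun j => A (lift ord_max j)].
Proof.
move=> /is_typeIP [sA pA]; apply/is_typeIP; split=> [j|f fk].
  by have := sA (lift ord_max j); rewrite !ffunE /snoc liftK.
have sf : (size (Phi * f)%R <= mabs km)%N.
  rewrite mabs_snoc (leq_trans (size_polyMleq _ _)) // sPhi addSn addnC.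
  by rewrite leq_add2r.
have := pA _ sf; rewrite pairing_snoc mulrCA (monic_op_ann mur_L Phi_op) addr0.
rewrite pairing_mulfun => ->; rewrite mabs_snoc; move: fk.
(* For |k| = 0 the predecessor truncates and the index shift fails, but then f = 0. *)
case: (mabs k) => [|n] fn; last by rewrite addSn addnC coef_mul_monic.
by move: fn; rewrite leqn0 size_poly_eq0 => /eqP->; rewrite mulr0 !coef0.
Qed.

(** A null vector B for [nuhat] extends by a last entry C to a null vector at (k, m), which
    normality forces to be 0. *)
Lemma null_typeI_mulfun B :
  normal (snoc nu mur) km -> null_typeI nuhat k B -> B = 0.
Proof.
move=> /normalP [_ null0] [sB pB].
have [m_gt0 murN0 _] := mur_L.
have mm : (0 < m <= m)%N by rewrite m_gt0 leqnn.
(* C cancels the pairings of B with the powers below m. *)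
have [C [sC pC]] := hankel_surj (fun p => - pairing nu B 'X^p) (murN0 m mm).
set A := [ffun i => snoc B C i].
have AB : [ffun j => A (lift ord_max j)] = B.
  by apply/ffunP => j; rewrite !ffunE /snoc liftK.
have AC : A ord_max = C by rewrite ffunE /snoc unlift_none.
have PhiN0 : Phi != 0 by rewrite monic_neq0.
suff A0 : A = 0 by rewrite -AB A0; apply/ffunP => j; rewrite !ffunE.
apply: null0; split=> [i|f fk].
  by rewrite !ffunE /snoc; case: unliftP => [j|] _; [exact: sB | exact: sC].
rewrite mabs_snoc in fk.
(* The remainder of f modulo Phi is annihilated by the choice of C. On the multiple of Phi, the C
   term drops out and B is null for [nuhat]. *)
rewrite (divp_eq f Phi) linearD /= [X in _ + X](scalar_eq0 (n := m)); first last.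
- by rewrite -ltnS -sPhi ltn_modp.
- by move=> p pm; rewrite [LHS]pairing_snoc AB AC pC // subrr.
rewrite addr0 pairing_snoc AB AC [_ * Phi]mulrC mulrCA.
rewrite (monic_op_ann mur_L Phi_op) addr0 -pairing_mulfun pB //.
by rewrite size_divp // sPhi leq_subLR addnC.
Qed.

Lemma normal_mulfun : normal (snoc nu mur) km -> normal nuhat k.
Proof.
move=> nkm; apply/normalP; split; last by move=> B; exact: null_typeI_mulfun.
by eexists; apply: is_typeI_restrict; exact: typeIP.
Qed.

Lemma typeI_mulfun j : normal (snoc nu mur) km ->
  typeI (snoc nu mur) km (lift ord_max j) = typeI nuhat k j.
Proof.
move=> nkm.
by rewrite (typeI_unique (normal_mulfun nkm) (is_typeI_restrict _ (typeIP nkm))) ffunE.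
Qed.

End Projection.
End Transform.

(** * Divisibility by simple roots and bordered determinants *)

Lemma dvdp_prod_XsubC {F : fieldType} {m : nat} (z : 'I_m -> F) (P : {poly F}) :
  injective z -> (forall i, P.[z i] = 0) -> \prod_(i < m) ('X - (z i)%:P) %| P.
Proof.
move=> z_inj P0; rewrite -(big_map z xpredT (fun x => 'X - x%:P)).
apply: uniq_roots_dvdp; last by rewrite uniq_rootsE map_inj_uniq // index_enum_uniq.
by apply/allP => _ /mapP [i _ ->]; apply/rootP.
Qed.

(* Adding to the first column the combination -c of the others clears its lower
   block. *)
Lemma det_bordered {F : fieldType} {n : nat} (a : {poly F}) (u : 'rV[{poly F}]_n)
    (v c : 'cV[F]_n) (M : 'M[F]_n) : M *m c = v ->
  \det (block_mx a%:M u (map_mx polyC v) (map_mx polyC M) : 'M_(1 + n)) =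
  (\det M)%:P * (a - \sum_b c b 0 *: u 0 b).
Proof.
move=> Mc; set X := block_mx _ _ _ _.
set T : 'M[{poly F}]_(1 + n) := block_mx 1%:M 0 (- map_mx polyC c) 1%:M.
have detT : \det T = 1 by rewrite det_lblock !det1 mulr1.
rewrite -[LHS]mulr1 -detT -det_mulmx mulmx_block !mulmx1 !mulmx0 !add0r.
rewrite !mulmxN -map_mxM Mc subrr det_ublock det_map_mx mulrC; congr (_ * _).
rewrite {1}[_ - _]mx11_scalar det_scalar1 !mxE eqxx mulr1n; congr (_ - _).
by apply: eq_bigr => b _; rewrite !mxE mulrC mul_polyC.
Qed.

(** * Linear combinations of the shifted type I vectors *)

Section Combinations.
Context {F : fieldType} {q m : nat}.
Variables (nu : 'I_q -> {scalar {poly F}}) (z : 'I_m -> F).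
Variables (s : nat -> {ffun 'I_q -> nat}) (k : {ffun 'I_q -> nat}).
Hypotheses (nu_perfect : perfect nu) (z_inj : injective z).
Hypothesis s_path : forall j, (j <= m * q)%N ->
  mabs (s j) = j /\ forall i, (s j i <= m)%N.
Implicit Types (c : 'cV[F]_(m * q)) (f : {poly F}).

Local Notation Phi := (\prod_(i < m) ('X - (z i)%:P)).
Local Notation nuhat :=
  (fun j : 'I_q => (mulfun Phi (nu j) : {scalar {poly F}})).

Definition typeI_comb c : {ffun 'I_q -> {poly F}} :=
  \sum_b c b 0 *: typeI nu (k + s b.+1).

Lemma typeI_combE c j :
  typeI_comb c j = \sum_b c b 0 *: typeI nu (k + s b.+1) j.
Proof. by rewrite sum_ffunE; apply: eq_bigr => b _; rewrite ffunE. Qed.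

Lemma size_typeI_comb c j : (size (typeI_comb c j) <= k j + m)%N.
Proof.
rewrite typeI_combE; apply: (leq_trans (size_sum _ _ _)); apply/bigmax_leqP => b _.
apply: (leq_trans (size_scale_leq _ _)).
have [sA _ _] := typeIP (nu_perfect (k + s b.+1)).
apply: (leq_trans (sA j)); rewrite ffunE leq_add2l.
by have [_ ->] := s_path _ (ltn_ord b).
Qed.

(** Multiplication by [Dmx] is evaluation of combinations at the nodes, so its kernel consists of
    the combinations vanishing at every node. *)
Lemma horner_typeI_comb c i j :
  (typeI_comb c j).[z i] = (Dmx nu z s k *m c) (mxvec_index i j) 0.
Proof.
rewrite typeI_combE horner_sum mxE; apply: eq_bigr => b _.
by rewrite hornerZ !mxE mxvecE mxE mulrC.
Qed.

Lemma pairing_typeI_shift (b : 'I_(m * q)) f :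
  (size f <= (mabs k + b).+1)%N ->
  pairing nu (typeI nu (k + s b.+1)) f = f`_(mabs k + b).
Proof.
have [sb _] := s_path _ (ltn_ord b).
have /is_typeIP [_ pA] := typeIP (nu_perfect (k + s b.+1)).
by move=> fk; rewrite pA mabsD sb addnS.
Qed.

Lemma pairing_typeI_comb c f :
  (size f <= mabs k)%N -> pairing nu (typeI_comb c) f = 0.
Proof.
move=> fk; rewrite pairing_suml big1 // => b _.
have fb : (size f <= mabs k + b)%N by rewrite (leq_trans fk) // leq_addr.
by rewrite pairing_typeI_shift ?(leqW fb) // nth_default // mulr0.
Qed.

Lemma typeI_comb_inj c : typeI_comb c = 0 -> c = 0.
Proof.
move=> c0; apply/colP => b; rewrite [RHS]mxE.
(* The auxiliary bound n gives strong induction on b. Testing on degree |k| + b, terms with larger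
   index pair to zero, and those with smaller index have coefficient zero by induction. *)
have [n bn] : exists n, (b < n)%N by exists b.+1.
elim: n b bn => // n IH b bn.
have : pairing nu (typeI_comb c) 'X^(mabs k + b) = 0.
  by rewrite c0 /pairing big1 // => j _; rewrite ffunE mul0r linear0.
rewrite pairing_suml (bigD1 b) //= pairing_typeI_shift ?size_polyXn //.
rewrite coefXn eqxx mulr1 big1 ?addr0 // => b' b'b.
have [lt|lt|/val_inj eq] := ltngtP b' b; last by rewrite eq eqxx in b'b.
  by rewrite IH ?mul0r // (leq_trans lt).
rewrite pairing_typeI_shift ?size_polyXn ?ltnS ?leq_add2l 1?ltnW //.
by rewrite coefXn eqn_add2l gtn_eqF // mulr0.
Qed.

Lemma divp_stackK (B : {ffun 'I_q -> {poly F}}) :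
  (forall i j, (B j).[z i] = 0) -> [ffun j => Phi * [ffun j => B j %/ Phi] j] = B.
Proof.
move=> B0; apply/ffunP => j; rewrite !ffunE mulrC divpK //.
exact: dvdp_prod_XsubC.
Qed.

Lemma size_Phi : size Phi = m.+1.
Proof. by rewrite -big_enum /= size_prod_XsubC size_enum_ord. Qed.

Lemma size_divPhi (P : {poly F}) n :
  (size P <= n + m)%N -> (size (P %/ Phi)%R <= n)%N.
Proof.
move=> Pn; rewrite size_divp ?size_Phi ?leq_subLR 1?addnC //.
by rewrite -size_poly_gt0 size_Phi.
Qed.

Lemma det_Dmx_neq0 :
  (forall B, null_typeI nuhat k B -> B = 0) -> \det (Dmx nu z s k) != 0.
Proof.
move=> null0; apply/negP; rewrite -det_tr => /det0P [v vN0 v0].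
have Dc0 : Dmx nu z s k *m v^T = 0 by rewrite -[LHS]trmxK trmx_mul trmxK v0 trmx0.
have B0 i j : (typeI_comb v^T j).[z i] = 0 by rewrite horner_typeI_comb Dc0 mxE.
case/negP: vN0; rewrite -(inj_eq trmx_inj) trmx0; apply/eqP/typeI_comb_inj.
(* Components of s are at most m, so dividing by Phi brings the degrees back within the bounds of
   k. *)
have Q0 : [ffun j => typeI_comb v^T j %/ Phi] = 0.
  apply: null0; split=> [j|f fk]; first by rewrite ffunE size_divPhi // size_typeI_comb.
  by rewrite pairing_mulfunl divp_stackK // pairing_typeI_comb.
by rewrite -(divp_stackK _ B0) Q0; apply/ffunP => j; rewrite !ffunE mulr0.
Qed.

Lemma typeI_mulfun_det j : normal nuhat k -> \det (Dmx nu z s k) != 0 ->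
  (\det (Dmx nu z s k))%:P * Phi * typeI nuhat k j
    = \det (bordered_mx nu z s k j).
Proof.
move=> nk D0; set D := Dmx nu z s k.
have Du : D \in unitmx by rewrite unitmxE unitfE.
(* These coefficients make the combination agree with A_k at all nodes, so E is divisible by Phi. *)
pose c := invmx D *m typeI_stack nu z k.
have Dc : D *m c = typeI_stack nu z k by rewrite mulKVmx.
pose E := typeI nu k - typeI_comb c.
have E0 i l : (E l).[z i] = 0.
  by rewrite !ffunE hornerD hornerN horner_typeI_comb -/D Dc !mxE mxvecE mxE subrr.
have /is_typeIP [sA pA] := typeIP (nu_perfect k).
have tE : is_typeI nuhat k [ffun l => E l %/ Phi].
  apply/is_typeIP; split=> [l|f fk].
    rewrite ffunE size_divPhi // !ffunE (leq_trans (size_polyD _ _)) //.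
    by rewrite size_polyN geq_max size_typeI_comb (leq_trans (sA l)) // leq_addr.
  (* The combination annihilates degrees below |k|, so E keeps the normalization of A_k. *)
  by rewrite pairing_mulfunl divp_stackK // pairingBl pairing_typeI_comb // subr0 pA.
rewrite (typeI_unique nk tE) -mulrA; have /ffunP/(_ j) := divp_stackK _ E0.
rewrite ffunE => ->; rewrite /bordered_mx (det_bordered _ _ _ _ _ Dc).
congr (_ * _); rewrite !ffunE typeI_combE; congr (_ - _).
by apply: eq_bigr => b _; rewrite mxE.
Qed.

End Combinations.

(** * The determinant formula, in the fraction field of polynomials *)

Theorem theorem3p14 (R : realType) (r m : nat)
    (nu : 'I_r.-1 -> {scalar {poly R[i]}}) (mur : {scalar {poly R[i]}})
    (z : 'I_m -> R[i]) (k : {ffun 'I_r.-1 -> nat})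
    (s : nat -> {ffun 'I_r.-1 -> nat}) :
  let Phi := \prod_(i < m) ('X - (z i)%:P) in
  let mu := snoc nu mur in
  let km := [ffun i => snoc k m i] in
  let nuhat := fun j => (mulfun Phi (nu j) : {scalar {poly R[i]}}) in
  let D := \det (Dmx nu z s k) in
  (2 <= r)%N ->
  (forall j, in_Linf (nu j)) ->
  perfect nu ->
  in_L m mur ->
  is_monic_op mur m Phi ->
  injective z ->
  (forall j, (j <= m * r.-1)%N -> mabs (s j) = j /\ forall i, (s j i <= m)%N) ->
  normal mu km ->
  [/\ D != 0,
      normal nuhat k
    & forall j : 'I_r.-1,
        typeI mu km (lift ord_max j) = typeI nuhat k j /\
        tofrac (typeI nuhat k j) =
          (tofrac Phi)^-1 * (tofrac D%:P)^-1
            * tofrac (\det (bordered_mx nu z s k j))].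
Proof.
move=> Phi mu km nuhat D _ _ nu_perfect mur_L Phi_op z_inj s_path nkm.
have [Phi_monic sPhi _] := Phi_op.
have D0 : D != 0.
  apply: det_Dmx_neq0 => // B.
  exact: (null_typeI_mulfun nu Phi Phi_monic sPhi mur k mur_L Phi_op B nkm).
have nk : normal nuhat k.
  exact: (normal_mulfun nu Phi Phi_monic sPhi mur k mur_L Phi_op nkm).
split=> // j; split.
  exact: (typeI_mulfun nu Phi Phi_monic sPhi mur k mur_L Phi_op j nkm).
(* The denominator-free identity is inserted, then Phi and D, both nonzero, cancel in the fraction
   field. *)
rewrite -(typeI_mulfun_det nu z s k nu_perfect z_inj s_path j nk D0) !tofracM.
have cancel (K : fieldType) (x y w : K) :
    x != 0 -> y != 0 -> w = x^-1 * y^-1 * (y * x * w).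
  by move=> x0 y0; rewrite -!mulrA mulKf // mulKf.
by apply: cancel; rewrite tofrac_eq0; [exact: monic_neq0 | rewrite polyC_eq0].
Qed.
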